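(* Let $p\geq 7$ be a prime number. Consider the left braces, up to isomorphism, with additive group $\mathbf{Z}_p\times C_{12}$ and multiplicative group a semidirect product $\mathbf{Z}_p\rtimes(C_6\times C_2)$. 1) If $p\equiv 11\pmod{12}$ there are 3 such braces. One of them is a direct product and the other two have a kernel of order 6. 2) If $p\equiv 7\pmod{12}$ there are 6 such braces. One of them is a direct product, two have kernel of order 6, two have kernels of order 2 and one has kernel of order 4. 3) If $p\equiv 5\pmod{12}$ there are 3 such braces. One of them is a direct product and the other two have a kernel of order 6. 4) If $p\equiv 1\pmod{12}$ there are 6 such braces. One of them is a direct product, two have kernel of order 6, two have kernels of order 2 and one has kernel of order 4.
   Context: A left brace is a set $B$ with operations $+,\cdot$ such that $(B,+)$ is an abelian group (additive group), $(B,\cdot)$ is a group (multiplicative group), and $a(b+c)=ab-a+ac$ for all $a,b,c\in B$. Isomorphisms are bijections preserving both operations. $\mathbf{Z}_m=\mathbf{Z}/m\mathbf{Z}$ and $C_m$ is the cyclic group of order $m$. Given a left brace $B'$ of size 12 with multiplicative group $F$ and a group morphism $\tau:F\to\mathrm{Aut}(\mathbf{Z}_p)\simeq\mathbf{Z}_p^*$, the semidirect product of the trivial brace $\mathbf{Z}_p$ (with $a\cdot b=a+b$) and $B'$ via $\tau$ is $\mathbf{Z}_p\times B'$ with componentwise addition and $(a,b)\cdot(a',b')=(a+\tau(b)a',bb')$; it is the direct product of braces when $\tau$ is trivial. For $p\geq 7$ every left brace of size $12p$ is isomorphic to one of this form. The kernel of the brace means $\ker\tau\subseteq F$. ''Multiplicative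 group $\mathbf{Z}_p\rtimes F$'' means isomorphic to $\mathbf{Z}_p\rtimes_\tau F$ for some $\tau$, possibly trivial. *)

(* Defs.v *)
From HB Require Import structures.
From mathcomp Require Import all_boot all_fingroup all_algebra.

Set Implicit Arguments.
Unset Strict Implicit.
Unset Printing Implicit Defensive.

Import GRing.Theory.
Local Open Scope ring_scope.

(* Additive notations (ring_scope) refer to the additive group of the brace,
   notations of group_scope to its multiplicative group. *)
HB.mixin Record Zmodule_Group_isLeftBrace B
    of GRing.Zmodule B & monoid.Group B := {
  braceDr : forall a b c : B, (a * (b + c)%R)%g = (a * b)%g - a + (a * c)%g
}.

#[short(type="leftBraceType")]
HB.structure Definition LeftBrace :=
  { B of GRing.Zmodule B & monoid.Group B & Zmodule_Group_isLeftBrace B }.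

Definition brace_iso (B C : leftBraceType) : Prop :=
  exists f : B -> C,
    [/\ bijective f, {morph f : x y / x + y} & {morph f : x y / (x * y)%g}].

Definition group_iso (G H : groupType) : Prop :=
  exists f : G -> H, bijective f /\ {morph f : x y / (x * y)%g}.

Definition zmod_iso (U V : zmodType) : Prop :=
  exists f : U -> V, bijective f /\ {morph f : x y / x + y}.

Definition has_card (T : eqType) (A : pred T) (n : nat) : Prop :=
  exists s : seq T, [/\ uniq s, s =i A & size s = n].

(* The group of units {unit 'Z_p} plays the role of Aut(Z_p). The definition is
   shared by groups F and left braces F; in the latter case Zp_sdprod tau is a
   left brace. It is a separate type because 'Z_p * F already carries the
   componentwise multiplication. *)
Definition Zp_sdprod (p : nat) (F : groupType)
  (tau : {multiplicative F -> {unit 'Z_p}}) : Type := ('Z_p * F)%type.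

Section ZpSdprodGroup.
Variables (p : nat) (F : groupType) (tau : {multiplicative F -> {unit 'Z_p}}).
Local Notation G := (Zp_sdprod tau).

HB.instance Definition _ := Choice.copy G ('Z_p * F)%type.

Definition Zp_sdprod_one : G := (0, 1%g).

Definition Zp_sdprod_inv (x : G) : G :=
  (- (val (tau x.2^-1%g) * x.1), x.2^-1%g).

Definition Zp_sdprod_mul (x y : G) : G :=
  (x.1 + val (tau x.2) * y.1, (x.2 * y.2)%g).

Lemma Zp_sdprod_tau1 : tau 1%g = 1%g.
Proof. by apply: (mulgI (tau 1%g)); rewrite -gmulfM !mulg1. Qed.

Lemma Zp_sdprod_mulA : associative Zp_sdprod_mul.
Proof.
move=> [a b] [c d] [e f]; rewrite /Zp_sdprod_mul /=; congr pair.
  by rewrite gmulfM /= mulrDr mulrA addrA.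
by rewrite mulgA.
Qed.

Lemma Zp_sdprod_mul1 : left_id Zp_sdprod_one Zp_sdprod_mul.
Proof.
by move=> [a b]; rewrite /Zp_sdprod_mul /= Zp_sdprod_tau1 /= mul1r add0r mul1g.
Qed.

Lemma Zp_sdprod_mulr1 : right_id Zp_sdprod_one Zp_sdprod_mul.
Proof. by move=> [a b]; rewrite /Zp_sdprod_mul /= mulr0 addr0 mulg1. Qed.

Lemma Zp_sdprod_mulV :
  left_inverse Zp_sdprod_one Zp_sdprod_inv Zp_sdprod_mul.
Proof. by move=> [a b]; rewrite /Zp_sdprod_mul /= addNr mulVg. Qed.

Lemma Zp_sdprod_mulrV :
  right_inverse Zp_sdprod_one Zp_sdprod_inv Zp_sdprod_mul.
Proof.
move=> [a b]; rewrite /Zp_sdprod_mul /= mulrN mulrA.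
have -> : val (tau b) * val (tau b^-1%g) = val (tau b * tau b^-1)%g by [].
by rewrite -gmulfM mulgV Zp_sdprod_tau1 mul1r subrr.
Qed.

HB.instance Definition _ := isGroup.Build G Zp_sdprod_mulA Zp_sdprod_mul1
  Zp_sdprod_mulr1 Zp_sdprod_mulV Zp_sdprod_mulrV.

End ZpSdprodGroup.

Section ZpSdprodBrace.
Variables (p : nat) (B : leftBraceType).
Variable tau : {multiplicative B -> {unit 'Z_p}}.
Local Notation G := (Zp_sdprod tau).

HB.instance Definition _ := GRing.Zmodule.copy G ('Z_p * B)%type.

Lemma Zp_sdprod_braceDr (x y z : G) :
  (x * (y + z)%R)%g = (x * y)%g - x + (x * z)%g.
Proof.
case: x y z => [a b] [c d] [e f]; congr pair => /=; last exact: braceDr.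
by rewrite mulrDr addrA [RHS]addrA subrK.
Qed.

HB.instance Definition _ := Zmodule_Group_isLeftBrace.Build G Zp_sdprod_braceDr.

End ZpSdprodBrace.

Definition is_sdprod_of (p : nat) (B B' : leftBraceType)
    (tau : {multiplicative B' -> {unit 'Z_p}}) : Prop :=
  has_card (@predT B') 12 /\ brace_iso B (Zp_sdprod tau).

Definition is_direct_product (p : nat) (B : leftBraceType) : Prop :=
  exists (B' : leftBraceType) (tau : {multiplicative B' -> {unit 'Z_p}}),
    is_sdprod_of B tau /\ forall b, tau b = 1%g.

(* The order of the kernel is required not to depend on the chosen
   decomposition of B as a semidirect product. *)
Definition has_kernel_of_order (p : nat) (B : leftBraceType) (k : nat) : Prop :=
  (exists (B' : leftBraceType) (tau : {multiplicative B' -> {unit 'Z_p}}),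
     is_sdprod_of B tau) /\
  (forall (B' : leftBraceType) (tau : {multiplicative B' -> {unit 'Z_p}}),
     is_sdprod_of B tau -> has_card [pred b | tau b == 1%g] k).

Definition has_groups (p : nat) (A : zmodType) (F : groupType)
    (B : leftBraceType) : Prop :=
  zmod_iso B ('Z_p * A)%type /\
  exists tau : {multiplicative F -> {unit 'Z_p}}, group_iso B (Zp_sdprod tau).

(* The number of isomorphism classes of left braces satisfying P is n; this is
   only meaningful for P invariant under isomorphism. *)
Definition num_brace_classes (P : leftBraceType -> Prop) (n : nat) : Prop :=
  exists s : 'I_n -> leftBraceType,
    [/\ forall i, P (s i),
        forall i j, brace_iso (s i) (s j) -> i = j
      & forall B, P B -> exists i, brace_iso B (s i)].

(* Main.v *)
From HB Require Import structures.
Require Import Defs.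
From mathcomp Require Import all_boot all_fingroup all_algebra.
From mathcomp Require Import ring.
From mathcomp Require cyclic pgroup.

(** Let B be a brace with additive group Z_p x Z_12 and multiplicative group
  Z_p x| F, F = C_6 x C_2. Write x * y = x + lambda_x(y), where lambda is an
  action of the multiplicative group on the additive one. As p does not divide
  12, each lambda_x preserves both additive factors, so it is a pair of
  multiplications by units, of 'Z_p and of 'Z_12 ([brace_opE]). The elements of
  the factor Z_p act trivially on both factors ([actp_Zp], [act12_Zp]): on Z_p,
  since the p-1 units of 'Z_p are too few for a faithful action, and on Z_12,
  since the units of 'Z_12 have square 1 and p is odd. Hence B is a semidirect
  product of Z_p by the brace living on the factor Z_12
  ([brace_op_sdprod]), and only the multiplicative group F of the latter is
  still to be exploited. Since F is commutative, a brace structure on Z_12 with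
  this group has the form a * b = a + b + c a b; the units of 'Z_12 leave only
  c = 0 and c = 6, and c = 0 gives a cyclic group ([act12E]). So every
  B is a semidirect product of Z_p by the single brace [B12], given by a
  character tau : [B12] -> Z_p^* ([has_groups_sdprod]).

  Conversely, an isomorphism of such semidirect products preserves the two
  additive torsion parts, and therefore restricts to an isomorphism of the
  braces of order 12 carrying one character to the other
  ([sdprod_iso_restrict]). The braces to count are thus the orbits of the
  automorphisms of [B12] on its characters, and orders of kernels are invariant.
  The multiplicative group of [B12] is generated by 4, of order 3, and by the
  two involutions 3 and 9. Its brace automorphisms are the multiplications by
  1, 5, 7 and 11: they exchange or fix 4 and 8 = 4 * 4, and independently
  exchange or fix 3 and 9 ([B12_aut], [B12_scale]). So an orbit is described by
  whether tau 4 is trivial, with a nontrivial value possible exactly for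
  p = 1 mod 3 ([cbrt1_ex]), and by the unordered pair of signs tau 3, tau 9:
  three orbits for tau 4 = 1, with kernels of order 12, 6, 6, and three more for
  p = 1 mod 3, with kernels of order 4, 2, 2. *)

Set Implicit Arguments.
Unset Strict Implicit.
Unset Printing Implicit Defensive.

Import GRing.Theory.

(** * Groups and their morphisms *)

Section GroupLemmas.
Local Open Scope group_scope.

Lemma eq_expg_mod (G : groupType) (x : G) n k l :
  x ^+ n = 1 -> k = l %[mod n] -> x ^+ k = x ^+ l.
Proof.
move=> xn e; rewrite (divn_eq k n) e [in RHS](divn_eq l n) !expgnDr.
by rewrite !(mulnC _ n) !expgnA xn !expg1n.
Qed.

Lemma expg_coprime (G : groupType) (x : G) n m :
  coprime n m -> x ^+ n = 1 -> x ^+ m = 1 -> x = 1.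
Proof.
case: n => [|n]; first by rewrite /coprime gcd0n => /eqP ->.
move=> c hn hm; have [a b h _] := @egcdnP n.+1 m isT.
have: x ^+ (a * n.+1) = x ^+ (b * m + gcdn n.+1 m) by rewrite h.
by rewrite mulnC expgnA hn expg1n expgnDr mulnC expgnA hm expg1n mul1g (eqP c).
Qed.

Lemma gmulf1 (G H : groupType) (f : {multiplicative G -> H}) : f 1 = 1.
Proof. by apply: (mulgI (f 1)); rewrite -gmulfM !mulg1. Qed.

Lemma gmulfX (G H : groupType) (f : {multiplicative G -> H}) n :
  {morph f : x / x ^+ n}.
Proof.
by move=> x; elim: n => [|n IH]; rewrite ?gmulf1 // !expgS gmulfM IH.
Qed.

Definition multiplicative_of_morph (G H : groupType) (f : G -> H)
    (fM : {morph f : x y / x * y}) : {multiplicative G -> H} :=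
  HB.pack f (isMultiplicative.Build _ _ f fM).

Lemma unit_mulgC p : @commutative {unit 'Z_p} _ *%g.
Proof. by move=> x y; apply: val_inj; rewrite /= mulrC. Qed.

Lemma Z6Z2_mulgC : @commutative ('Z_6 * 'Z_2)%type _ *%g.
Proof. by move=> [a b] [c d]; congr pair; apply: Zp_mulgC. Qed.

Lemma Z6Z2_exp6 (w : ('Z_6 * 'Z_2)%type) : w ^+ 6 = 1.
Proof.
case: w => -[[|[|[|[|[|[|//]]]]]] ?] -[[|[|//]] ?]; congr pair; exact: val_inj.
Qed.

End GroupLemmas.

(** * Additive maps between groups with coprime torsion *)

Section AdditiveMaps.
Local Open Scope ring_scope.

Lemma morphD_mulrn (V W : zmodType) (h : V -> W) :
  {morph h : x y / x + y} -> h 0 = 0 /\ forall k x, h (x *+ k) = h x *+ k.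
Proof.
move=> hD; have h0 : h 0 = 0 by apply: (addrI (h 0)); rewrite -hD !addr0.
by split=> // k x; elim: k => [|k IH]; rewrite ?mulr0n // !mulrS hD IH.
Qed.

(** Translation by x permutes V, hence does not change the sum of all elements
  of V; but it adds n copies of x to this sum. *)
Lemma has_card_mulrn (V : zmodType) n (x : V) :
  has_card (@predT V) n -> x *+ n = 0.
Proof.
move=> [s [us hs <-]].
have ps: perm_eq s (map (+%R x) s).
  apply: uniq_perm => //; first by rewrite map_inj_uniq //; apply: addrI.
  move=> y; rewrite hs; apply/esym/mapP; exists (y - x); rewrite ?hs ?inE //.
  by rewrite addrC subrK.
have: \sum_(y <- s) y = \sum_(y <- map (+%R x) s) y by apply: perm_big.
rewrite big_map big_split /= => /esym/eqP.
rewrite -subr_eq0 addrK big_const_seq count_predT iter_addr_0.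
by move/eqP.
Qed.

Lemma mulrn_coprime (V : zmodType) (x : V) n m :
  coprime n m -> x *+ n = 0 -> x *+ m = 0 -> x = 0.
Proof.
case: n => [|n]; first by rewrite /coprime gcd0n => /eqP ->.
move=> c hn hm; have [a b h _] := @egcdnP n.+1 m isT.
move: (congr1 (GRing.natmul x) h).
by rewrite mulnC mulrnA hn mul0rn mulrnDr mulnC mulrnA hm mul0rn add0r (eqP c).
Qed.

Lemma mulrn_modulus p (p_gt1 : (1 < p)%N) (a : 'Z_p) : a *+ p = 0.
Proof. by rewrite -mulr_natr pchar_Zp // mulr0. Qed.

Lemma pair_mulrn (V W : zmodType) (x : V * W) k :
  x *+ k = (x.1 *+ k, x.2 *+ k).
Proof. by elim: k => [|k IH]; rewrite ?mulr0n // !mulrS IH. Qed.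

(** The two factors are the p-torsion and the n-torsion of the product, so an
  additive map respects them; on 'Z_p it is a multiplication. *)
Lemma additive_diag p n (V W : zmodType) (h : 'Z_p * V -> 'Z_p * W) :
  (1 < p)%N -> coprime p n ->
  (forall x : V, x *+ n = 0) -> (forall x : W, x *+ n = 0) ->
  {morph h : x y / x + y} ->
  forall a b, h (a, b) = (a * (h (1, 0)).1, (h (0, b)).2).
Proof.
move=> p_gt1 pn nV nW hD a b; have [h0 hn] := morphD_mulrn hD.
have -> : (a, b) = ((1, 0) : 'Z_p * V) *+ a + (0, b).
  by rewrite pair_mulrn mul0rn natr_Zp; congr pair; rewrite ?addr0 ?add0r.
have e1 : (h (0, b)).1 = 0.
  apply: (mulrn_coprime pn); first exact: mulrn_modulus.
  have := hn n (0, b); rewrite pair_mulrn /= nV mul0rn h0.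
  by rewrite pair_mulrn => /(congr1 fst).
have e2 : (h (1, 0)).2 = 0.
  apply: (mulrn_coprime pn) => //.
  have := hn p (1, 0); rewrite pair_mulrn /= mulrn_modulus // mul0rn h0.
  by rewrite pair_mulrn => /(congr1 snd).
rewrite hD hn pair_mulrn e2 mul0rn; congr pair => /=; last by rewrite add0r.
by rewrite e1 addr0 -{2}(natr_Zp a) mulr_natl.
Qed.

Lemma Zp_additiveE p (g : 'Z_p -> 'Z_p) :
  {morph g : x y / x + y} -> forall x, g x = x * g 1.
Proof.
move=> gD x; have [_ gn] := morphD_mulrn gD.
by rewrite -{1}(natr_Zp x) gn -{2}(natr_Zp x) mulr_natl.
Qed.

End AdditiveMaps.

(** * The brace of order 12 *)

Lemma Z12_ind (P : pred 'Z_12) :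
  all P [seq inZp i | i <- iota 0 12] -> forall x, P x.
Proof.
move=> /allP h x; rewrite -(valZpK x); apply: h; apply: map_f.
by rewrite mem_iota ltn_ord.
Qed.

(** The brace a * b = a + b + 6 a b on 'Z_12, a synonym of 'Z_12 because the
  latter already carries its additive group as a multiplicative structure. *)
Definition B12 : Type := 'Z_12.
HB.instance Definition _ := GRing.Zmodule.copy B12 'Z_12.

Local Notation "n %:B" := (inZp n : B12) (at level 2).

Section B12Brace.
Local Open Scope ring_scope.

Definition B12_mul (a b : B12) : B12 :=
  (a : 'Z_12) + b + 6%:R * ((a : 'Z_12) * b).
Definition B12_inv (a : B12) : B12 :=
  - (a : 'Z_12) + 6%:R * ((a : 'Z_12) * a).

Lemma Z12_mul36 (x : 'Z_12) : 36%:R * x = 0.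
Proof. by rewrite (_ : 36%:R = 0) ?mul0r //; apply: val_inj. Qed.

Lemma B12_mulA : associative B12_mul.
Proof.
move=> a b c; rewrite /B12_mul.
set x : 'Z_12 := a; set y : 'Z_12 := b; set z : 'Z_12 := c.
ring.
Qed.

Lemma B12_mul1 : left_id (0 : B12) B12_mul.
Proof. by move=> a; rewrite /B12_mul mul0r mulr0 addr0 add0r. Qed.

Lemma B12_mulr1 : right_id (0 : B12) B12_mul.
Proof. by move=> a; rewrite /B12_mul !mulr0 !addr0. Qed.

Lemma B12_mulV : left_inverse (0 : B12) B12_inv B12_mul.
Proof.
move=> a; rewrite /B12_mul /B12_inv; set x : 'Z_12 := a.
have -> : - x + 6%:R * (x * x) + x + 6%:R * ((- x + 6%:R * (x * x)) * x)
          = 36%:R * (x * x * x) by ring.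
exact: Z12_mul36.
Qed.

Lemma B12_mulrV : right_inverse (0 : B12) B12_inv B12_mul.
Proof.
move=> a; rewrite /B12_mul /B12_inv; set x : 'Z_12 := a.
have -> : x + (- x + 6%:R * (x * x)) + 6%:R * (x * (- x + 6%:R * (x * x)))
          = 36%:R * (x * x * x) by ring.
exact: Z12_mul36.
Qed.

HB.instance Definition _ :=
  isGroup.Build B12 B12_mulA B12_mul1 B12_mulr1 B12_mulV B12_mulrV.

Lemma B12_braceDr (a b c : B12) :
  (a * (b + c)%R)%g = (a * b)%g - a + (a * c)%g.
Proof.
pose x : 'Z_12 := a; pose y : 'Z_12 := b; pose z : 'Z_12 := c.
change (x + (y + z) + 6%:R * (x * (y + z)) =
        x + y + 6%:R * (x * y) - x + (x + z + 6%:R * (x * z))).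
ring.
Qed.

HB.instance Definition _ := Zmodule_Group_isLeftBrace.Build B12 B12_braceDr.

Lemma B12_card : has_card (@predT B12) 12.
Proof.
exists [seq inZp i : 'Z_12 | i <- iota 0 12]; split=> //.
move=> x; rewrite inE; move: x.
by apply: (@Z12_ind (fun x => x \in [seq inZp i | i <- iota 0 12])); vm_compute.
Qed.

(** The exponents of 3 and of 9 in the decomposition of x in the multiplicative
  group, <4> x <3> x <9>; the exponent of 4 is x modulo 3. *)
Definition chi3 (x : B12) : nat := (x %% 4 \in [:: 2; 3])%N.
Definition chi9 (x : B12) : nat := (x %% 4 \in [:: 1; 2])%N.

Lemma B12_gen (x : B12) : x = (4%:B ^+ x * 3%:B ^+ chi3 x * 9%:B ^+ chi9 x)%g.
Proof. by apply/eqP; move: x; apply: Z12_ind; vm_compute. Qed.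

Lemma B12_exponentsM (x y : B12) :
  [/\ ((x * y)%g : B12) = x + y %[mod 3],
      chi3 (x * y)%g = chi3 x + chi3 y %[mod 2]
    & chi9 (x * y)%g = chi9 x + chi9 y %[mod 2]]%N.
Proof.
pose P (x y : B12) := [&& ((x * y)%g : B12) == x + y %[mod 3],
  chi3 (x * y)%g == chi3 x + chi3 y %[mod 2]
  & chi9 (x * y)%g == chi9 x + chi9 y %[mod 2]]%N.
suff h : P x y by case/and3P: h => /eqP h1 /eqP h2 /eqP h3.
by move: y; apply: Z12_ind; move: x; apply: Z12_ind; vm_compute.
Qed.

(** The multiplicative group of [B12] is C_6 x C_2, with generators 7 = 4 * 3
  and 9. *)
Definition B12_toF (x : B12) : ('Z_6 * 'Z_2)%type :=
  (inZp (4 * x + 3 * chi3 x), inZp (chi9 x)).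
Definition B12_ofF (w : ('Z_6 * 'Z_2)%type) : B12 :=
  (7%:B ^+ w.1 * 9%:B ^+ w.2)%g.

Lemma B12_toFM : {morph B12_toF : x y / (x * y)%g}.
Proof.
move=> x y; apply/eqP; move: y; apply: Z12_ind; move: x; apply: Z12_ind.
by vm_compute.
Qed.

Lemma B12_toFK : cancel B12_toF B12_ofF.
Proof. by move=> x; apply/eqP; move: x; apply: Z12_ind; vm_compute. Qed.

Lemma B12_ofFK : cancel B12_ofF B12_toF.
Proof.
case=> -[[|[|[|[|[|[|//]]]]]] ?] -[[|[|//]] ?]; congr pair; exact: val_inj.
Qed.

Lemma B12_ofFM : {morph B12_ofF : x y / (x * y)%g}.
Proof.
by move=> x y; rewrite -[x]B12_ofFK -[y]B12_ofFK -B12_toFM !B12_toFK.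
Qed.

(** An additive automorphism of 'Z_12 is a multiplication by 1, 5, 7 or 11. *)
Lemma B12_aut (g : B12 -> B12) :
  bijective g -> {morph g : x y / x + y} ->
  (g 4%:B = 4%:B \/ g 4%:B = 8%:B) /\
  (g 3%:B = 3%:B /\ g 9%:B = 9%:B \/ g 3%:B = 9%:B /\ g 9%:B = 3%:B).
Proof.
move=> bg gD; have [g0 _] := morphD_mulrn gD.
have gE (x : B12) : g x = (x : 'Z_12) * g 1%:B by apply: (@Zp_additiveE 12 g gD).
set k : 'Z_12 := g 1%:B in gE.
have ne (x : B12) : x != 0 -> (x : 'Z_12) * k != 0.
  by apply: contraNN => /eqP e; apply/eqP; apply: (bij_inj bg); rewrite gE g0.
(* k is a unit since neither 6 k nor 4 k vanishes. *)
have h6 := ne 6%:B isT; have h4 := ne 4%:B isT.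
pose P (k : 'Z_12) :=
  (inZp 6 * k != 0 :> 'Z_12) && (inZp 4 * k != 0 :> 'Z_12) ==>
  (inZp 4 * k \in [:: inZp 4; inZp 8 : 'Z_12]) &&
  ((inZp 3 * k == inZp 3 :> 'Z_12) && (inZp 9 * k == inZp 9 :> 'Z_12) ||
   (inZp 3 * k == inZp 9 :> 'Z_12) && (inZp 9 * k == inZp 3 :> 'Z_12)).
have: P k by apply: Z12_ind; vm_compute.
rewrite /P h6 h4 /= !inE !gE => /andP[/orP h /orP h']; split.
  by case: h => /eqP; auto.
by case: h' => /andP[/eqP ? /eqP ?]; auto.
Qed.

(** Multiplication by a unit k is a brace automorphism, since k is odd and
  hence 6 k = 6. *)
Lemma B12_scale (k : 'Z_12) : k * k = 1 ->
  let g (x : B12) := (k * (x : 'Z_12)) : B12 in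
  [/\ bijective g, {morph g : x y / x + y} & {morph g : x y / (x * y)%g}].
Proof.
move=> kk g; split.
- by exists g => x; rewrite /g mulrA kk mul1r.
- exact: mulrDr.
- move=> x y; rewrite /g.
  have h : 6%:R * k = 6%:R.
    apply/eqP; suff: (k * k == 1) ==> (6%:R * k == 6%:R) by rewrite kk.
    by move: (k); apply: Z12_ind; vm_compute.
  pose a : 'Z_12 := x; pose b : 'Z_12 := y.
  rewrite -[LHS]/(k * (a + b + 6%:R * (a * b))).
  rewrite -[RHS]/(k * a + k * b + 6%:R * ((k * a) * (k * b))).
  have -> : k * a * (k * b) = k * k * (a * b) by ring.
  have -> : k * (a + b + 6%:R * (a * b)) = k * a + k * b + 6%:R * k * (a * b)
    by ring.
  by rewrite kk mul1r h.
Qed.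

End B12Brace.

(** * Characters of the brace of order 12 *)

Section Characters.
Local Open Scope group_scope.
Variable p : nat.
Local Notation T := {unit 'Z_p}.
Implicit Types (z a b : T) (t : {multiplicative B12 -> T}).

Definition char_fun z a b (x : B12) : T := z ^+ x * a ^+ chi3 x * b ^+ chi9 x.

Lemma char_funM z a b : z ^+ 3 = 1 -> a ^+ 2 = 1 -> b ^+ 2 = 1 ->
  {morph char_fun z a b : x y / x * y}.
Proof.
move=> hz ha hb x y; have [h1 h2 h3] := B12_exponentsM x y.
rewrite /char_fun (eq_expg_mod hz h1) (eq_expg_mod ha h2) (eq_expg_mod hb h3).
rewrite !expgnDr.
move: (z ^+ x) (z ^+ y) (a ^+ _) (a ^+ _) (b ^+ _) (b ^+ _).
by move=> z1 z2 a1 a2 b1 b2; apply: val_inj => /=; ring.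
Qed.

Definition char_of z a b (hz : z ^+ 3 = 1) (ha : a ^+ 2 = 1) (hb : b ^+ 2 = 1) :
  {multiplicative B12 -> T} := multiplicative_of_morph (char_funM hz ha hb).

Lemma char_ofE z a b hz ha hb : let t := @char_of z a b hz ha hb in
  [/\ t 4%:B = z, t 3%:B = a & t 9%:B = b].
Proof.
rewrite /= /char_fun.
have e4 : [/\ (4%:B : nat) = 4, chi3 4%:B = 0 & chi9 4%:B = 0]%N by [].
have e3 : [/\ (3%:B : nat) = 3, chi3 3%:B = 1 & chi9 3%:B = 0]%N by [].
have e9 : [/\ (9%:B : nat) = 9, chi3 9%:B = 0 & chi9 9%:B = 1]%N by [].
case: e4 e3 e9 => -> -> -> [-> -> ->] [-> -> ->].
rewrite !expg0 !expg1 !mulg1.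
by rewrite (@eq_expg_mod _ z 3 4 1) // (@eq_expg_mod _ z 3 9 0) // hz !mul1g.
Qed.

Lemma eq_char t1 t2 :
  t1 4%:B = t2 4%:B -> t1 3%:B = t2 3%:B -> t1 9%:B = t2 9%:B -> t1 =1 t2.
Proof.
by move=> e4 e3 e9 x; rewrite (B12_gen x) !gmulfM !gmulfX e4 e3 e9.
Qed.

Lemma char_exp t :
  [/\ t 4%:B ^+ 3 = 1, t 3%:B ^+ 2 = 1 & t 9%:B ^+ 2 = 1].
Proof.
rewrite -!gmulfX (_ : _ ^+ 3 = 1) 1?(_ : 3%:B ^+ 2 = 1) 1?(_ : 9%:B ^+ 2 = 1).
- by rewrite gmulf1.
all: exact: val_inj.
Qed.

Lemma char8 t : t 8%:B = t 4%:B ^+ 2.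
Proof. by rewrite -gmulfX; congr (t _); apply: val_inj. Qed.

End Characters.

(** * Isomorphisms of semidirect products *)

Section Isomorphisms.
Local Open Scope ring_scope.

Lemma brace_iso_refl B : brace_iso B B.
Proof. by exists id; split=> //; exists id. Qed.

Lemma brace_iso_sym B C : brace_iso B C -> brace_iso C B.
Proof.
move=> [f [[g fK gK] fD fM]]; exists g; split; first by exists f.
  by move=> x y; rewrite -{1}(gK x) -{1}(gK y) -fD fK.
by move=> x y; rewrite -{1}(gK x) -{1}(gK y) -fM fK.
Qed.

Lemma brace_iso_trans B C D :
  brace_iso B C -> brace_iso C D -> brace_iso B D.
Proof.
move=> [f [bf fD fM]] [g [bg gD gM]]; exists (g \o f).
split; first exact: bij_comp.
  by move=> x y /=; rewrite fD gD.
by move=> x y /=; rewrite fM gM.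
Qed.

Lemma brace_iso_sdprod p (B1 B2 : leftBraceType)
    (t1 : {multiplicative B1 -> {unit 'Z_p}})
    (t2 : {multiplicative B2 -> {unit 'Z_p}}) (g : B1 -> B2) :
  bijective g -> {morph g : x y / x + y} -> {morph g : x y / (x * y)%g} ->
  (forall x, t1 x = t2 (g x)) -> brace_iso (Zp_sdprod t1) (Zp_sdprod t2).
Proof.
move=> [h gK hK] gD gM e; exists (fun u : 'Z_p * B1 => (u.1, g u.2)); split.
- by exists (fun u : 'Z_p * B2 => (u.1, h u.2)); case=> a b /=; rewrite ?gK ?hK.
- by move=> [a b] [c d] /=; congr pair; rewrite -gD.
- by move=> [a b] [c d] /=; congr pair => /=; rewrite ?e.
Qed.

(** An isomorphism f is additively diagonal: multiplication by some k on 'Z_p,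
  and a map g on the other factor. Comparing the images of the product
  (0, x) * (1, 0) = (t1 x, x) gives t1 x k = t2 (g x) k, and k is a unit. *)
Lemma sdprod_iso_restrict p n (B1 B2 : leftBraceType)
    (t1 : {multiplicative B1 -> {unit 'Z_p}})
    (t2 : {multiplicative B2 -> {unit 'Z_p}}) :
  (1 < p)%N -> coprime p n ->
  has_card (@predT B1) n -> has_card (@predT B2) n ->
  brace_iso (Zp_sdprod t1) (Zp_sdprod t2) ->
  exists g : B1 -> B2,
    [/\ bijective g, {morph g : x y / x + y}, {morph g : x y / (x * y)%g}
      & forall x, t1 x = t2 (g x)].
Proof.
move=> p_gt1 pn c1 c2 iso.
have n1 (x : B1) := has_card_mulrn x c1.
have n2 (x : B2) := has_card_mulrn x c2.
have [f [[f' fK fK'] fD fM]] := iso.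
have fD' : {morph f' : x y / x + y}.
  by move=> x y; rewrite -{1}(fK' x) -{1}(fK' y) -fD fK.
have E := @additive_diag p n B1 B2 f p_gt1 pn n1 n2 fD.
have E' := @additive_diag p n B2 B1 f' p_gt1 pn n2 n1 fD'.
set k := (f (1, 0)).1 in E; set k' := (f' (1, 0)).1 in E'.
have kk : k * k' = 1.
  have := fK (1, 0); rewrite E mul1r E' => /(congr1 fst) //.
pose g b := (f (0, b)).2; pose g' b := (f' (0, b)).2.
have Eg b : f (0, b) = (0, g b) by rewrite E mul0r.
have Eg' b : f' (0, b) = (0, g' b) by rewrite E' mul0r.
exists g; split.
- exists g' => b.
    by have := fK (0, b); rewrite Eg Eg' => /(congr1 snd).
  by have := fK' (0, b); rewrite Eg' Eg => /(congr1 snd).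
- move=> x y; have := fD (0, x) (0, y).
  have -> : (0, x) + (0, y) = (0, x + y) :> Zp_sdprod t1.
    by congr pair; rewrite /= addr0.
  by rewrite !Eg => /(congr1 snd).
- move=> x y.
  have e : f (0 + val (t1 x) * 0, (x * y)%g) = (f (0%R, x) * f (0%R, y))%g.
    exact: (fM (0, x) (0, y)).
  by move: e; rewrite mulr0 addr0 !Eg => /(congr1 snd).
- move=> x.
  have e : f (0 + val (t1 x) * 1, (x * 0)%g) = (f (0%R, x) * f (1%R, 0%R))%g.
    exact: (fM (0, x) (1, 0)).
  have {e} e1 :
      (0 + val (t1 x) * 1) * k = 0 * k + val (t2 (g x)) * (1 * k).
    by move: (congr1 fst e); rewrite (E _ _) (E 0 x) (E 1 0).
  move: e1; rewrite mulr1 add0r mul0r add0r mul1r => e.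
  by apply: val_inj; rewrite -[LHS]mulr1 -[RHS]mulr1 -kk !mulrA e.
Qed.

Lemma is_sdprod_of_iso p (B C B' : leftBraceType)
    (t : {multiplicative B' -> {unit 'Z_p}}) :
  brace_iso B C -> is_sdprod_of B t -> is_sdprod_of C t.
Proof.
by move=> h [c i]; split=> //; apply: brace_iso_trans i; apply: brace_iso_sym.
Qed.

Lemma is_direct_product_iso p (B C : leftBraceType) :
  brace_iso B C -> is_direct_product p B -> is_direct_product p C.
Proof.
by move=> h [B' [t [s e]]]; exists B', t; split=> //; apply: is_sdprod_of_iso s.
Qed.

Lemma has_kernel_of_order_iso p k (B C : leftBraceType) :
  brace_iso B C -> has_kernel_of_order p B k -> has_kernel_of_order p C k.
Proof.
move=> h [[B' [t s]] e]; split.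
  by exists B', t; apply: is_sdprod_of_iso s.
move=> D u s'; apply: e; apply: is_sdprod_of_iso s'; exact: brace_iso_sym.
Qed.

Lemma has_groups_sdprod_B12 p (t : {multiplicative B12 -> {unit 'Z_p}}) :
  has_groups p 'Z_12 ('Z_6 * 'Z_2)%type (Zp_sdprod t).
Proof.
split; first by exists id; split=> //; exists id.
have tM : {morph (t \o B12_ofF) : x y / (x * y)%g}.
  by move=> x y /=; rewrite B12_ofFM gmulfM.
exists (multiplicative_of_morph tM).
exists (fun u : 'Z_p * B12 => (u.1, B12_toF u.2)); split.
  exists (fun u : 'Z_p * ('Z_6 * 'Z_2) => (u.1, B12_ofF u.2)).
    by case=> a b /=; rewrite B12_toFK.
  by case=> a b /=; rewrite B12_ofFK.
move=> [a b] [c d]; congr pair; last exact: B12_toFM.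
by rewrite /= B12_toFK.
Qed.

End Isomorphisms.

(** * Braces with the given groups are semidirect products *)

Lemma brace_oneE (B : leftBraceType) : 1%g = 0%R :> B.
Proof.
have := @braceDr B 1%g 0%R 0%R; rewrite !mul1g !addr0 add0r => /esym/eqP.
by rewrite oppr_eq0 => /eqP.
Qed.

Section Structure.
Local Open Scope ring_scope.
Variable p : nat.
Hypothesis p_gt1 : (1 < p)%N.
Hypothesis p12 : coprime p 12.
Hypothesis Zp_unit : forall a : 'Z_p, a != 0 -> a \is a GRing.unit.
Hypothesis unit2 : (2%:R : 'Z_p) \is a GRing.unit.

Variable B : leftBraceType.
Local Notation U := ('Z_p * 'Z_12)%type.
Variables (phi : B -> U) (psi : U -> B).
Hypotheses (phiK : cancel phi psi) (psiK : cancel psi phi).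
Hypothesis phiD : {morph phi : x y / x + y}.

Let psiD : {morph psi : x y / x + y}.
Proof. by move=> x y; rewrite -{1}(psiK x) -{1}(psiK y) -phiD phiK. Qed.

Let psi0 : psi 0 = 1%g.
Proof. by rewrite brace_oneE; case: (morphD_mulrn psiD). Qed.

Let phi1 : phi 1%g = 0.
Proof. by rewrite -psi0 psiK. Qed.

Definition brace_op x y := phi (psi x * psi y)%g.
Definition brace_opV x := phi (psi x)^-1%g.
Local Notation op := brace_op.

Let opA x y z : op x (op y z) = op (op x y) z.
Proof. by rewrite /op !phiK mulgA. Qed.

Let op0x x : op 0 x = x.
Proof. by rewrite /op psi0 mul1g psiK. Qed.

Let opV x : op x (brace_opV x) = 0.
Proof. by rewrite /op /brace_opV phiK mulgV phi1. Qed.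

Let lambdaD x y z : op x (y + z) - x = (op x y - x) + (op x z - x).
Proof.
have -> : op x (y + z) = op x y - x + op x z; last by rewrite addrA.
rewrite /op psiD braceDr !phiD; congr (_ + _ + _).
apply: (addrI (phi (psi x))); rewrite -phiD !subrr psiK subrr.
by case: (morphD_mulrn phiD).
Qed.

(** lambda_x is multiplication by [actp x] on 'Z_p and by [act12 x] on
  'Z_12. *)
Definition actp x := (op x (1, 0) - x).1.
Definition act12 x := (op x (0, 1) - x).2.

Lemma brace_opE x y : op x y = (x.1 + y.1 * actp x, x.2 + y.2 * act12 x).
Proof.
have n12 (z : 'Z_12) : z *+ 12 = 0 := @mulrn_modulus 12 isT z.
have E := additive_diag p_gt1 p12 n12 n12 (lambdaD x).
rewrite -[LHS](subrK x) addrC (surjective_pairing y) E.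
congr pair => /=; congr (_ + _).
set h := (fun b : 'Z_12 => (op x (0, b) - x).2).
have hD : {morph h : a b / a + b}.
  move=> a b; rewrite /h; have := lambdaD x (0, a) (0, b).
  rewrite (_ : (0, a) + (0, b) = (0, a + b)) => [-> //|].
  by congr pair; rewrite /= addr0.
exact: (Zp_additiveE hD y.2).
Qed.

Lemma act_op x y :
  actp (op x y) = actp x * actp y /\ act12 (op x y) = act12 x * act12 y.
Proof.
have e := opA x y (1, 1).
rewrite (brace_opE y) (brace_opE x) (brace_opE (op x y)) /= !mul1r in e.
have [o1 o2] : (op x y).1 = x.1 + y.1 * actp x /\
               (op x y).2 = x.2 + y.2 * act12 x by rewrite brace_opE.
split; [move: (congr1 fst e) | move: (congr1 snd e)] => /=.
  rewrite o1 mulrDl addrA => h; apply: (addrI (x.1 + y.1 * actp x)).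
  by rewrite -h [actp x * _]mulrC.
rewrite o2 mulrDl addrA => h; apply: (addrI (x.2 + y.2 * act12 x)).
by rewrite -h [act12 x * _]mulrC.
Qed.

Lemma act0 : actp 0 = 1 /\ act12 0 = 1.
Proof. by rewrite /actp /act12 !op0x !subr0. Qed.

Lemma act_opV x : actp x * actp (brace_opV x) = 1 /\
                  act12 x * act12 (brace_opV x) = 1.
Proof.
by case: (act_op x (brace_opV x)) => <- <-; rewrite opV; exact: act0.
Qed.

Lemma actp_unit x : actp x \is a GRing.unit.
Proof.
case: (act_opV x) => h _; apply/unitrP; exists (actp (brace_opV x)).
by rewrite mulrC h.
Qed.

Lemma act12_sq x : act12 x * act12 x = 1.
Proof.
have [_ h] := act_opV x.
pose P (a : 'Z_12) := [pred b : 'Z_12 | (a * b == 1) ==> (a * a == 1)].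
have : P (act12 x) (act12 (brace_opV x)).
  move: (act12 (brace_opV x)); apply: Z12_ind.
  by move: (act12 x); apply: Z12_ind; vm_compute.
by rewrite /P /= h eqxx => /eqP.
Qed.

(** Either some b != 0 acts trivially on 'Z_p, and then so do its multiples,
  that is, all of 'Z_p; or the action is faithful, an injection of 'Z_p into
  itself that must take the non-unit value 0. *)
Lemma actp_Zp a : actp (a, 0) = 1.
Proof.
pose f a := actp (a, 0); rewrite -/(f a).
have fU c : f c \is a GRing.unit by apply: actp_unit.
have fM c d : f (c + d * f c) = f c * f d.
  by have [<- _] := act_op (c, 0) (d, 0); rewrite brace_opE /= mul0r addr0.
have [/existsP [b /andP[b0 /eqP fb]]|] := boolP [exists b, (b != 0) && (f b == 1)].
  have fbD c : f (b + c) = f c by have := fM b c; rewrite fb mulr1 mul1r.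
  have fbk k : f (b *+ k) = 1.
    elim: k => [|k IH]; first by rewrite mulr0n /f; case: act0.
    by rewrite mulrS fbD.
  by rewrite -(fbk (a / b : 'Z_p)) -mulr_natl natr_Zp divrK ?Zp_unit.
rewrite negb_exists => /forallP h.
have fI : injective f.
  move=> c d e; pose l := (d - c) / f c.
  have ed : d = c + l * f c by rewrite divrK ?fU // addrC subrK.
  have : f d = f c * f l by rewrite {1}ed fM.
  rewrite -e -{1}[f c]mulr1 => /(mulrI (fU c)) fl.
  move: (h l); rewrite -fl eqxx andbT negbK => /eqP l0.
  by rewrite ed l0 mul0r addr0.
have [g _ gK] := injF_bij fI.
by have := fU (g 0); rewrite gK unitr0.
Qed.

(** (a, 0) is the square of (a / 2, 0), and units of 'Z_12 have square 1. *)
Lemma act12_Zp a : act12 (a, 0) = 1.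
Proof.
have -> : (a, 0) = op (a / 2%:R, 0) (a / 2%:R, 0).
  rewrite brace_opE /= actp_Zp mulr1 mul0r addr0; congr pair.
  by rewrite /= -mulrDl -mulr2n -(mulr_natr a 2) mulrK.
by case: (act_op (a / 2%:R, 0) (a / 2%:R, 0)) => _ ->; rewrite act12_sq.
Qed.

Local Notation mu h := (actp (0, h)).
Local Notation nu h := (act12 (0, h)).

(** As (a, h) is the product of (a, 0) and (0, h), it acts like (0, h). *)
Lemma brace_op_sdprod x y :
  op x y = (x.1 + y.1 * mu x.2, x.2 + y.2 * nu x.2).
Proof.
rewrite brace_opE; have -> : x = op (x.1, 0) (0, x.2).
  rewrite brace_opE actp_Zp act12_Zp (surjective_pairing x) /=.
  by congr pair; rewrite /= ?mulr1 ?addr0 ?add0r.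
have [-> ->] := act_op (x.1, 0) (0, x.2).
rewrite actp_Zp act12_Zp !mul1r brace_opE actp_Zp act12_Zp /= !mulr1.
by rewrite addr0 add0r.
Qed.

Lemma act_Z12M a b :
  mu (a + b * nu a) = mu a * mu b /\ nu (a + b * nu a) = nu a * nu b.
Proof.
by have [<- <-] := act_op (0, a) (0, b); rewrite brace_op_sdprod /= mul0r addr0.
Qed.

(** Its image is a multiplicative complement, of order 12, of the normal factor
  'Z_p. *)
Definition emb12 (h : 'Z_12) := psi (0, h).
Local Notation k := emb12.

Lemma emb12_inj : injective k.
Proof. by move=> a b /(can_inj psiK) []. Qed.

Lemma emb12_0 : k 0 = 1%g.
Proof. exact: psi0. Qed.

Lemma emb12M a b : (k a * k b)%g = k (a + b * nu a).
Proof. by rewrite /k -[LHS]phiK -/(op _ _) brace_op_sdprod /= mul0r addr0. Qed.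

Lemma emb12X a i : exists b, (k a ^+ i)%g = k b.
Proof.
elim: i => [|i [b e]]; first by exists 0; rewrite emb12_0.
by exists (a + b * nu a); rewrite expgS e emb12M.
Qed.

(** A square acts trivially on 'Z_12, so that its powers are its multiples. *)
Lemma emb12_exp24 a : (k a ^+ 24 = 1)%g.
Proof.
rewrite (expgnA _ 2 12) expg2 emb12M; set b := _ + _.
have nb : nu b = 1 by case: (act_Z12M a a) => _ ->; exact: act12_sq.
suff -> i : (k b ^+ i = k (b *+ i))%g by rewrite (@mulrn_modulus 12 isT) emb12_0.
elim: i => [|i IH]; first by rewrite mulr0n emb12_0.
by rewrite expgS IH emb12M nb mulr1 mulrS.
Qed.

Variable t0 : {multiplicative ('Z_6 * 'Z_2)%type -> {unit 'Z_p}}.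
Variable theta : B -> Zp_sdprod t0.
Hypothesis theta_inj : injective theta.
Hypothesis thetaM : {morph theta : x y / (x * y)%g}.

Let theta1 : theta 1%g = 1%g.
Proof. by apply: (mulgI (theta 1%g)); rewrite -thetaM !mulg1. Qed.

Let thetaX x i : (theta (x ^+ i) = theta x ^+ i)%g.
Proof. by elim: i => [|i IH]; rewrite ?theta1 // !expgS thetaM IH. Qed.

Let sdprod_expg2 (u : Zp_sdprod t0) i : ((u ^+ i)%g).2 = (u.2 ^+ i)%g.
Proof. by elim: i => [|i IH]; rewrite ?expg0 // !expgS -IH. Qed.

(** The projection to C_6 x C_2 is injective on the complement: an element of
  its kernel has order dividing p, hence coprime to 24. *)
Lemma emb12_ker a : (theta (k a)).2 = 1%g -> a = 0.
Proof.
move=> e; apply: emb12_inj; rewrite emb12_0.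
apply: (@expg_coprime _ _ p 24) (emb12_exp24 a).
  by rewrite (coprimeMr p 2 12) p12 andbT (coprime_dvdr _ p12).
apply: theta_inj; rewrite thetaX theta1.
have E i : (theta (k a) ^+ i)%g = ((theta (k a)).1 *+ i, 1%g) :> Zp_sdprod t0.
  elim: i => [|i IH]; first by rewrite mulr0n.
  rewrite expgS IH; case: (theta (k a)) e => u v /= ->.
  rewrite mulrS; congr pair; last by rewrite /= mulg1.
  by rewrite Zp_sdprod_tau1 /= mul1r.
by rewrite E (mulrn_modulus p_gt1).
Qed.

(** The complement is commutative, like its image in C_6 x C_2. *)
Lemma emb12_comm a b : a + b * nu a = b + a * nu b.
Proof.
apply: emb12_inj; rewrite -!emb12M.
set x := (k a * k b)%g; set y := (k b * k a)%g.
(* y ^+ 23 is the inverse of y; as a power it visibly lies in the complement. *)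
have [c ec] : exists c, (x * y ^+ 23)%g = k c.
  rewrite /x /y !emb12M; have [d ->] := emb12X (b + a * nu b) 23.
  by rewrite emb12M; eexists.
have y24 : (y ^+ 24 = 1)%g by rewrite /y emb12M emb12_exp24.
suff c0 : (x * y ^+ 23 = 1)%g.
  by apply: (mulIg (y ^+ 23)%g); rewrite c0 -expgS.
rewrite ec; suff -> : c = 0 by exact: emb12_0.
apply: emb12_ker; rewrite -ec thetaM thetaX.
have exy : (theta x).2 = (theta y).2 by rewrite /x /y !thetaM /= Z6Z2_mulgC.
transitivity ((theta x).2 * (theta y ^+ 23).2)%g; first by [].
rewrite sdprod_expg2 exy -expgS.
transitivity (theta y ^+ 24)%g.2; first by rewrite sdprod_expg2.
by rewrite -thetaX y24 theta1.
Qed.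

(** Commutation with 1 shows that nu is affine, of slope c = nu 1 - 1. Units of
  'Z_12 square to 1, which at the values nu 1 and nu 2 leaves c = 0 and c = 6;
  and for c = 0 the complement would be cyclic of order 12, whereas C_6 x C_2
  has exponent 6. *)
Lemma act12E a : nu a = 1 + 6%:R * a.
Proof.
have h b : nu b = 1 + b * (nu 1 - 1).
  have := emb12_comm b 1; rewrite mul1r => e; apply: (addrI b); rewrite e; ring.
rewrite h mulrC; congr (1 + _ * _); set c := nu 1 - 1.
have h1 := act12_sq (0, 1); have h2 := act12_sq (0, 1 + 1).
rewrite h -/c in h1; rewrite h -/c in h2.
have : (c == 0) || (c == 6%:R).
  have : ((1 + 1 * c) * (1 + 1 * c) == 1) &&
         ((1 + (1 + 1) * c) * (1 + (1 + 1) * c) == 1) ==>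
         ((c == 0) || (c == 6%:R)).
    by move: (c); apply: Z12_ind; vm_compute.
  by rewrite h1 h2 eqxx.
case/orP => /eqP // c0; exfalso.
have nu1 b : nu b = 1 by rewrite h -/c c0 mulr0 addr0.
suff: (6%:R : 'Z_12) = 0 by apply/eqP.
apply: emb12_ker.
have -> : k 6%:R = (k 1%R ^+ 6)%g.
  have kD i : (k 1%R ^+ i)%g = k i%:R.
    elim: i => [|i IH]; first by rewrite mulr0n emb12_0.
    by rewrite expgS IH emb12M nu1 mulr1 mulrS.
  by rewrite kD.
by rewrite thetaX sdprod_expg2 Z6Z2_exp6.
Qed.

Definition brace_char (a : B12) : {unit 'Z_p} :=
  FinRing.unit _ (actp_unit (0, a)).

Lemma brace_charM : {morph brace_char : x y / (x * y)%g}.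
Proof.
move=> a b; apply: val_inj => /=.
case: (act_Z12M a b) => <- _; congr (mu _).
rewrite act12E; pose x : 'Z_12 := a; pose y : 'Z_12 := b.
by rewrite -[LHS]/(x + y + 6%:R * (x * y)) -/x -/y; ring.
Qed.

Lemma brace_sdprod :
  exists t : {multiplicative B12 -> {unit 'Z_p}}, brace_iso B (Zp_sdprod t).
Proof.
exists (multiplicative_of_morph brace_charM).
exists (phi : B -> Zp_sdprod (multiplicative_of_morph brace_charM)); split.
- by exists psi.
- exact: phiD.
- move=> x y; have := brace_op_sdprod (phi x) (phi y).
  rewrite /op !phiK => ->; congr pair; first by rewrite mulrC.
  rewrite act12E; set a := (phi x).2; set b := (phi y).2.
  by rewrite -[RHS]/(a + b + 6%:R * (a * b)); ring.
Qed.

End Structure.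

(** * Roots of unity modulo a prime *)

Section PrimeUnits.
Variable p : nat.
Hypothesis p_pr : prime p.
Local Open Scope ring_scope.
Local Notation T := {unit 'Z_p}.

(** The field 'F_p is by definition 'Z_(pdiv p), and pdiv p = p. *)
Lemma Zp_prime_unit (a : 'Z_p) : a != 0 -> a \is a GRing.unit.
Proof.
suff: forall b : 'Z_(pdiv p), b != 0 -> b \is a GRing.unit.
  by rewrite pdiv_id // => h /h.
by move=> b b0; apply: etrans (@unitfE 'F_p b) b0.
Qed.

Lemma Zp_prime_mul0 (a b : 'Z_p) : a * b = 0 -> a = 0 \/ b = 0.
Proof.
have [->|a0] := eqVneq a 0; first by left.
by move=> e; right; apply: (mulrI (Zp_prime_unit a0)); rewrite e mulr0.
Qed.

Lemma sqrt1_cases (y m : T) :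
  val m = -1 -> (y ^+ 2 = 1)%g -> y = 1%g \/ y = m.
Proof.
move=> hm h; have: (val y - 1) * (val y + 1) = 0.
  have e : val y * val y = 1 by move: (congr1 val h).
  by transitivity (val y * val y - 1); [ring | rewrite e subrr].
case/Zp_prime_mul0 => /eqP.
  by rewrite subr_eq0 => /eqP e; left; apply: val_inj.
by rewrite addr_eq0 => /eqP e; right; apply: val_inj; rewrite /= hm.
Qed.

Lemma cbrt1_cases (z y : T) :
  (z != 1 -> z ^+ 3 = 1 -> y ^+ 3 = 1 -> [\/ y = 1, y = z | y = z ^+ 2])%g.
Proof.
move=> z1 hz hy.
have {}hz : val z * val z * val z = 1 by move: (congr1 val hz); rewrite /= mulrA.
have {}hy : val y * val y * val y = 1 by move: (congr1 val hy); rewrite /= mulrA.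
have hs : 1 + val z + val z * val z = 0.
  have : (val z - 1) * (1 + val z + val z * val z) = 0.
    transitivity (val z * val z * val z - 1); [ring | by rewrite hz subrr].
  case/Zp_prime_mul0 => // /eqP; rewrite subr_eq0 => /eqP e.
  by case/eqP: z1; apply: val_inj.
have : (val y - 1) * ((val y - val z) * (val y - val z * val z)) = 0.
  transitivity (val y * val y * val y - val z * val z * val z +
    (val y * val z - val y * val y) * (1 + val z + val z * val z)); first by ring.
  by rewrite hy hz hs mulr0 subrr addr0.
case/Zp_prime_mul0; last case/Zp_prime_mul0.
all: move/eqP; rewrite subr_eq0 => /eqP e.
- by constructor 1; apply: val_inj.
- by constructor 2; apply: val_inj.
- by constructor 3; apply: val_inj.
Qed.

Lemma card_units_prime : #|units_Zp p| = p.-1.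
Proof. by rewrite card_units_Zp ?prime_gt0 // totient_prime. Qed.

(** The element z is a primitive cube root of unity if there is one, and 1
  otherwise; both cases generate all the cube roots of unity. *)
Lemma cbrt1_ex : exists z : T,
  [/\ (z ^+ 3 = 1)%g, (z != 1%g) = (p %% 3 == 1)%N &
      forall y : T, (y ^+ 3 = 1)%g -> [\/ y = 1, y = z | y = z ^+ 2]%g].
Proof.
have p3 : (p %% 3 == 1)%N = (3 %| p.-1)%N.
  rewrite -{1}(prednK (prime_gt0 p_pr)) /dvdn -addn1 -modnDml.
  by case: (_ %% 3)%N (ltn_pmod p.-1 (isT : 0 < 3)%N) => [|[|[|]]].
have [d|nd] := boolP (3 %| p.-1)%N.
  have [z _ oz] : {z : T | z \in units_Zp p & #[z]%g = 3%N}.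
    by apply: pgroup.Cauchy => //; rewrite card_units_prime.
  have z1 : z != 1%g by rewrite -order_eq1 oz.
  have z3 : (z ^+ 3 = 1)%g by rewrite -oz expg_order.
  by exists z; split; rewrite ?p3 ?z1 ?d // => y; apply: cbrt1_cases.
exists 1%g; split; rewrite ?expg1n ?p3 ?eqxx ?(negPf nd) // => y y3.
constructor 1; apply: (@expg_coprime _ y p.-1 3) => //.
  by rewrite coprime_sym prime_coprime.
by rewrite -card_units_prime cyclic.expg_cardG ?inE.
Qed.

End PrimeUnits.

(** * Counting *)

Section CountingTools.

Lemma num_classes_of_seq (I : eqType) (M : I -> leftBraceType) (s : seq I)
    (P : leftBraceType -> Prop) :
  uniq s -> {in s, forall i, P (M i)} ->
  {in s &, forall i j, brace_iso (M i) (M j) -> i = j} ->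
  (forall B, P B -> exists2 i, i \in s & brace_iso B (M i)) ->
  num_brace_classes P (size s).
Proof.
move=> us sP sI sB; exists (fun k => M (tnth (in_tuple s) k)); split.
- by move=> k; apply/sP/mem_tnth.
- move=> k l /sI e; have/tuple_uniqP: uniq (in_tuple s) by [].
  by apply; apply: e; apply: mem_tnth.
- by move=> B /sB [i /(tnthP (in_tuple s)) [k ->] iso]; exists k.
Qed.

Lemma num_classes_ext (P Q : leftBraceType -> Prop) k :
  (forall B, P B <-> Q B) -> num_brace_classes P k -> num_brace_classes Q k.
Proof.
move=> PQ [s [sP sI sB]].
by exists s; split=> // [i|B /PQ /sB //]; apply/PQ.
Qed.

Lemma has_card_unique (T : eqType) (A : pred T) n m :
  has_card A n -> has_card A m -> n = m.
Proof.
move=> [s [us sA <-]] [t [ut tA <-]]; apply: perm_size; apply: uniq_perm => // x.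
by rewrite sA tA.
Qed.

Lemma has_card_bij (T U : eqType) (g : T -> U) (A : pred T) (C : pred U) n :
  bijective g -> (forall x, A x = C (g x)) -> has_card A n -> has_card C n.
Proof.
move=> [h gK hK] e [s [us sA <-]]; exists (map g s); split; last exact: size_map.
  by rewrite map_inj_uniq //; apply: can_inj gK.
move=> y; rewrite -[y]hK mem_map; last exact: can_inj gK.
by rewrite sA [LHS]e.
Qed.

End CountingTools.

Section Classification.
Local Open Scope ring_scope.
Variable p : nat.
Hypothesis p_pr : prime p.
Hypothesis p_ge7 : (7 <= p)%N.
Local Notation T := {unit 'Z_p}.
Local Notation F := ('Z_6 * 'Z_2)%type.

Let p_gt1 : (1 < p)%N. Proof. exact: prime_gt1. Qed.

Let coprime_small n : (0 < n < 7)%N -> coprime p n.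
Proof.
case/andP=> n0 n7; rewrite prime_coprime //; apply: contraL n7 => /dvdn_leq h.
by rewrite -leqNgt (leq_trans p_ge7) ?h.
Qed.

Let p12 : coprime p 12.
Proof. by rewrite (coprimeMr p 4 3) !coprime_small. Qed.

Let unit2 : (2%:R : 'Z_p) \is a GRing.unit.
Proof. by rewrite unitZpE // coprime_small. Qed.

Lemma has_groups_sdprod B : has_groups p 'Z_12 F B ->
  exists t : {multiplicative B12 -> T}, brace_iso B (Zp_sdprod t).
Proof.
move=> [[phi [[psi phiK psiK] phiD]] [t0 [th [bth thM]]]].
exact: (brace_sdprod p_gt1 p12 (Zp_prime_unit p_pr) unit2 phiK psiK phiD
                     (bij_inj bth) thM).
Qed.

Lemma iso_by_scale (k : 'Z_12) (t t' : {multiplicative B12 -> T}) :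
  k * k = 1 -> t 4%:B = t' (k * (4%:B : 'Z_12)) ->
  t 3%:B = t' (k * (3%:B : 'Z_12)) -> t 9%:B = t' (k * (9%:B : 'Z_12)) ->
  brace_iso (Zp_sdprod t) (Zp_sdprod t').
Proof.
move=> kk h4 h3 h9; have [gb gD gM] := B12_scale kk.
set g := (fun x : B12 => _) in gb gD gM.
have tM : {morph (t' \o g) : x y / (x * y)%g}.
  by move=> x y; rewrite /= [X in t' X]gM gmulfM.
apply: (brace_iso_sdprod gb gD gM).
exact: (@eq_char _ t (multiplicative_of_morph tM)).
Qed.

Variable z m : T.
Hypothesis z3 : (z ^+ 3 = 1)%g.
Hypothesis zP : forall y : T, (y ^+ 3 = 1)%g -> [\/ y = 1, y = z | y = z ^+ 2]%g.
Hypothesis hm : val m = -1.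

Let m2 : (m ^+ 2 = 1)%g.
Proof. by apply: val_inj; rewrite /= hm mulrNN mulr1. Qed.

Let m_neq1 : m != 1%g.
Proof.
apply/eqP => /(congr1 val); rewrite hm /= => /eqP.
rewrite eq_sym -addr_eq0 => /eqP e.
by have := unit2; rewrite -[2%:R]/(1 + 1 : 'Z_p) e unitr0.
Qed.

Let z_sq : (z ^+ 2 = 1 -> z = 1)%g.
Proof. by move=> e; move: z3; rewrite expgS e mulg1. Qed.

Lemma sign_cases (y : T) : (y ^+ 2 = 1)%g -> exists b : bool, y = (m ^+ b)%g.
Proof. by case/(sqrt1_cases p_pr hm) => ->; [exists false | exists true]. Qed.

Lemma sign_inj (a b : bool) : (m ^+ a = m ^+ b)%g -> a = b.
Proof.
have nm := negP m_neq1; case: a b => -[] //; rewrite expg0 expg1 => e.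
  by case: nm; rewrite e.
by case: nm; rewrite -e.
Qed.

Lemma expgb_exp (y : T) k (b : bool) : (y ^+ k = 1 -> (y ^+ b) ^+ k = 1)%g.
Proof. by case: b; rewrite ?expg0 ?expg1n. Qed.

(** The index (w, (a, b)) stands for the character with value z ^ w at 4,
  (-1) ^ a at 3 and (-1) ^ b at 9. *)
Definition index := (bool * (bool * bool))%type.

Definition tau (i : index) : {multiplicative B12 -> T} :=
  char_of (expgb_exp i.1 z3) (expgb_exp i.2.1 m2) (expgb_exp i.2.2 m2).

Definition model i : leftBraceType := Zp_sdprod (tau i).

(** Each orbit contains exactly one character with a valid index: w is
  meaningful only if z is primitive, and b ==> a orders the two signs. *)
Definition valid (i : index) := (i.1 ==> (z != 1%g)) && (i.2.2 ==> i.2.1).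

Lemma tauE i :
  [/\ tau i 4%:B = z ^+ i.1, tau i 3%:B = m ^+ i.2.1 & tau i 9%:B = m ^+ i.2.2]%g.
Proof. exact: char_ofE. Qed.

(** Multiplication by 5 exchanges 4 and 8, so that it replaces the value z ^ 2 at
  4 by z; multiplication by 7 exchanges 3 and 9, and the two signs. *)
Lemma char_classification (t : {multiplicative B12 -> T}) :
  exists2 i, valid i & brace_iso (Zp_sdprod t) (model i).
Proof.
have [h4 h3 h9] := char_exp t.
have [a ea] := sign_cases h3; have [b eb] := sign_cases h9.
have [w [c [vw e4]]] : exists w c : bool,
    (w ==> (z != 1%g)) /\ t 4%:B = ((z ^+ w) ^+ c.+1)%g.
  have [z1|z1] := eqVneq z 1%g.
    by exists false, false; split=> //; case: (zP h4) => ->; rewrite ?z1 ?expg1n.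
  case: (zP h4) => ->.
  - by exists false, false.
  - by exists true, false.
  - by exists true, true.
have [a' [b' [s [vs ea' eb']]]] : exists a' b' s : bool,
    [/\ b' ==> a', a = (if s then b' else a') & b = (if s then a' else b')].
  case: a {ea} => /=; last by exists b, false, true; split.
  by exists true, b, false; split=> //; case: b {eb}.
exists (w, (a', b')); first by rewrite /valid /= vw.
have [E4 E3 E9] := tauE (w, (a', b')).
pose k : 'Z_12 := (if c then inZp 5 else inZp 1) * (if s then inZp 7 else inZp 1).
apply: (@iso_by_scale k).
- by rewrite /k; case: (c); case: (s); apply: val_inj.
- have -> : k * (4%:B : 'Z_12) = ((4%:B : B12) ^+ c.+1)%g.
    by rewrite /k; case: (c); case: (s); apply: val_inj.
  by rewrite gmulfX E4.
- have -> : k * (3%:B : 'Z_12) = if s then 9%:B else 3%:B :> B12.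
    by rewrite /k; case: (c); case: (s); apply: val_inj.
  by case: (s) ea' => e; rewrite ?E3 ?E9 ea e.
- have -> : k * (9%:B : 'Z_12) = if s then 3%:B else 9%:B :> B12.
    by rewrite /k; case: (c); case: (s); apply: val_inj.
  by case: (s) eb' => e; rewrite ?E3 ?E9 eb e.
Qed.

Lemma model_inj i j :
  valid i -> valid j -> brace_iso (model i) (model j) -> i = j.
Proof.
move=> /andP[vi vi'] /andP[vj vj'].
case/(sdprod_iso_restrict p_gt1 p12 B12_card B12_card) => g [gb gD gM gt].
have [g4 g39] := B12_aut gb gD.
have := gt 4%:B; have := gt 3%:B; have := gt 9%:B.
have [-> -> ->] := tauE i; have [e4 e3 e9] := tauE j => h9 h3 h4.
have ew : i.1 = j.1.
  move: h4 vi vj; case: g4 => ->; rewrite ?char8 e4; case: (i.1); case: (j.1) => //=;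
    rewrite ?expg0 ?expg1 ?expg1n.
  - by move=> ->; rewrite eqxx.
  - by move=> <-; rewrite eqxx.
  - by move=> ->; rewrite eqxx.
  - by move=> /esym/z_sq ->; rewrite eqxx.
have es : i.2 = j.2.
  case: g39 h3 h9 => -[-> ->]; rewrite e3 e9 => /sign_inj h3 /sign_inj h9.
    by rewrite (surjective_pairing i.2) (surjective_pairing j.2) h3 h9.
  move: vi' vj'; rewrite (surjective_pairing i.2) (surjective_pairing j.2) h3 h9 /=.
  by case: (j.2.1); case: (j.2.2).
by rewrite (surjective_pairing i) (surjective_pairing j) ew es.
Qed.

Definition in_kernel (i : index) (x : B12) : bool :=
  (i.1 ==> (3 %| x)%N) && ~~ odd (i.2.1 * chi3 x + i.2.2 * chi9 x).

Definition kernel_size (i : index) :=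
  size [seq x <- [seq inZp n : B12 | n <- iota 0 12] | in_kernel i x].

(** The value at x is the product of a cube root of unity and a sign, which is 1
  only if both factors are. *)
Lemma in_kernelE i x : valid i -> (tau i x == 1%g) = in_kernel i x.
Proof.
move=> /andP[vi _]; rewrite -[tau i x]/(char_fun _ _ _ x) /char_fun -mulgA.
rewrite -!expgnA -!expgnDr.
set n := (i.2.1 * chi3 x + i.2.2 * chi9 x)%N.
have -> : (m ^+ n = m ^+ (odd n))%g.
  by apply: (eq_expg_mod m2); rewrite !modn2 oddb.
rewrite /in_kernel -/n; set e := odd _.
have Ez : (z ^+ (i.1 * x) == 1%g)%g = (i.1 ==> (3 %| x)%N).
  case: (i.1) vi => /=; last by rewrite mul0n expg0 eqxx.
  rewrite mul1n => z1; rewrite -(eq_expg_mod z3 (modn_mod x 3)) /dvdn.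
  case: (_ %% 3)%N (ltn_pmod x (isT : 0 < 3)%N) => [|[|[|//]]] _; rewrite ?eqxx //.
    exact: negbTE.
  by apply/negbTE; apply: contraNneq z1 => /z_sq ->.
rewrite -Ez; case: (e); rewrite ?andbT ?andbF ?expg0 ?mulg1 // expg1.
apply/negbTE; apply: contraNneq m_neq1 => h.
have : ((z ^+ (i.1 * x) * m) ^+ 3 = 1)%g by rewrite h expg1n.
rewrite expgMn; last exact: unit_mulgC.
rewrite -!expgnA mulnC expgnA z3 expg1n mul1g => <-.
by rewrite expgS m2 mulg1.
Qed.

Lemma tau_kernel i :
  valid i -> has_card [pred x | tau i x == 1%g] (kernel_size i).
Proof.
move=> vi; eexists; split; last by [].
  by apply: filter_uniq.
move=> x; rewrite mem_filter; apply: etrans (esym (in_kernelE x vi)).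
suff -> : x \in [seq inZp n : B12 | n <- iota 0 12] by rewrite andbT.
by move: x; apply: Z12_ind; vm_compute.
Qed.

Lemma model_sdprod i : is_sdprod_of (model i) (tau i).
Proof. by split; [exact: B12_card | exact: brace_iso_refl]. Qed.

Lemma model_sdprod_char i (B' : leftBraceType) (t : {multiplicative B' -> T}) :
  is_sdprod_of (model i) t ->
  exists2 g : B12 -> B', bijective g & forall x, tau i x = t (g x).
Proof.
move=> [c /(sdprod_iso_restrict p_gt1 p12 B12_card c) [g [gb _ _ gt]]].
by exists g.
Qed.

Lemma has_kernel_model i k :
  valid i -> has_kernel_of_order p (model i) k <-> kernel_size i = k.
Proof.
move=> vi; split.
  by move=> [_ h]; apply: has_card_unique (tau_kernel vi) (h _ _ (model_sdprod i)).
move=> <-; split; first by exists B12, (tau i); apply: model_sdprod.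
move=> B' t /model_sdprod_char [g gb gt]; apply: has_card_bij gb _ (tau_kernel vi).
by move=> x; rewrite -[RHS]/(t (g x) == 1%g) -gt.
Qed.

Lemma is_direct_model i :
  valid i -> is_direct_product p (model i) <-> i = (false, (false, false)).
Proof.
move=> vi; split=> [[B' [t [/model_sdprod_char [g _ gt] t1]]]|->].
  have e x : tau i x = 1%g by rewrite gt.
  have [] := tauE i; rewrite !e; case: i vi {gt e} => -[] [a b] /andP[/= vi _].
    by rewrite expg1 => e; rewrite -e eqxx in vi.
  by move=> _ /(@sign_inj false) <- /(@sign_inj false) <-.
exists B12, (tau (false, (false, false))); split; first exact: model_sdprod.
by move=> x; apply/eqP; rewrite in_kernelE.
Qed.

Definition indices : seq index :=
  [seq i <- [:: (false, (false, false)); (false, (true, false));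
                (false, (true, true)); (true, (false, false));
                (true, (true, false)); (true, (true, true))]
     | i.1 ==> (z != 1%g)].

Lemma mem_indices i : (i \in indices) = valid i.
Proof.
by rewrite mem_filter /valid; congr (_ && _); case: i => -[] [[] []].
Qed.

Lemma num_classes_model (Q : leftBraceType -> Prop) (q : pred index) :
  (forall B C, brace_iso B C -> Q B -> Q C) ->
  (forall i, valid i -> Q (model i) <-> q i) ->
  num_brace_classes (fun B => has_groups p 'Z_12 F B /\ Q B) (count q indices).
Proof.
move=> Qiso Qq; rewrite -size_filter.
have mem_q i : (i \in filter q indices) = q i && valid i.
  by rewrite mem_filter mem_indices.
apply: (@num_classes_of_seq _ model).
- by rewrite !filter_uniq.
- move=> i; rewrite mem_q => /andP[qi vi]; split.
    exact: has_groups_sdprod_B12.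
  exact/(Qq _ vi).
- by move=> i j; rewrite !mem_q => /andP[_ vi] /andP[_ vj]; exact: model_inj.
- move=> B [/has_groups_sdprod [t iso] QB].
  have [i vi iso'] := char_classification t.
  have isoi := brace_iso_trans iso iso'.
  by exists i => //; rewrite mem_q vi andbT; apply/(Qq _ vi); apply: Qiso QB.
Qed.

Lemma num_braces : num_brace_classes (has_groups p 'Z_12 F) (size indices).
Proof.
rewrite -count_predT.
by apply: num_classes_ext (@num_classes_model (fun=> True) predT _ _) => // B; tauto.
Qed.

Lemma num_direct :
  num_brace_classes (fun B => has_groups p 'Z_12 F B /\ is_direct_product p B)
    (count_mem (false, (false, false)) indices).
Proof.
apply: num_classes_model; first exact: is_direct_product_iso.
by move=> i vi; apply: iff_trans (is_direct_model vi) _; apply: rwP eqP.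
Qed.

Lemma num_kernel k :
  num_brace_classes
    (fun B => has_groups p 'Z_12 F B /\ has_kernel_of_order p B k)
    (count (fun i => kernel_size i == k) indices).
Proof.
apply: num_classes_model; first exact: has_kernel_of_order_iso.
by move=> i vi; apply: iff_trans (has_kernel_model k vi) _; apply: rwP eqP.
Qed.

End Classification.

(* In the group ('Z_6 * 'Z_2)%type the group law is componentwise addition, so
   that this is C_6 x C_2. *)
Theorem proposition13 (p : nat) (p_prime : prime p) (p_ge7 : (7 <= p)%N) :
  let braces (B : leftBraceType) :=
    has_groups p 'Z_12 ('Z_6 * 'Z_2)%type B in
  let direct (B : leftBraceType) := braces B /\ is_direct_product p B in
  let kernel_order (k : nat) (B : leftBraceType) :=
    braces B /\ has_kernel_of_order p B k in
  [/\ (p = 11 %[mod 12])%N ->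
      [/\ num_brace_classes braces 3,
          num_brace_classes direct 1
        & num_brace_classes (kernel_order 6) 2],
      (p = 7 %[mod 12])%N ->
      [/\ num_brace_classes braces 6,
          num_brace_classes direct 1,
          num_brace_classes (kernel_order 6) 2,
          num_brace_classes (kernel_order 2) 2
        & num_brace_classes (kernel_order 4) 1],
      (p = 5 %[mod 12])%N ->
      [/\ num_brace_classes braces 3,
          num_brace_classes direct 1
        & num_brace_classes (kernel_order 6) 2]
    & (p = 1 %[mod 12])%N ->
      [/\ num_brace_classes braces 6,
          num_brace_classes direct 1,
          num_brace_classes (kernel_order 6) 2,
          num_brace_classes (kernel_order 2) 2
        & num_brace_classes (kernel_order 4) 1]].
Proof.
move=> braces direct kernel_order.
have [z [z3 z1 zP]] := cbrt1_ex p_prime.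
have U : (-1 : 'Z_p)%R \is a GRing.unit by rewrite unitrN1.
pose m : {unit 'Z_p} := FinRing.unit _ U.
have hm : val m = (-1)%R by [].
have A := num_braces p_prime p_ge7 z3 zP hm.
have D := num_direct p_prime p_ge7 z3 zP hm.
have K := num_kernel p_prime p_ge7 z3 zP hm.
have K6 := K 6; have K2 := K 2; have K4 := K 4.
have p3 (r : nat) : p = r %[mod 12] -> (z != 1%g) = (r %% 3 == 1).
  by rewrite z1 -(@modn_dvdm 12 p 3) // => ->; rewrite modn_dvdm.
(* Once z != 1 is decided, the list of indices and all counts on it compute. *)
by split=> /p3 b; rewrite /indices b in A D K6 K2 K4.
Qed.
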